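(* For all $a,b>0$ with $a\ne b$, $$L(a,b)<AGM(a,b)<L(a,b)^{3/4}A(a,b)^{1/4}<TQ(a,b)<\frac34L(a,b)+\frac14A(a,b)<A_{1/2}(a,b)<\mathcal{T}_{1/3}(a,b)<\mathcal{I}_{3/4}(a,b).$$
   Context: For $a,b>0$ with $a\ne b$: the logarithmic mean is $L(a,b)=\frac{b-a}{\ln b-\ln a}$; the arithmetic mean is $A(a,b)=\frac{a+b}{2}$; the power mean of order $1/2$ is $A_{1/2}(a,b)=\left(\frac{a^{1/2}+b^{1/2}}{2}\right)^{2}$; the identric (exponential) mean is $\mathcal{I}(a,b)=e^{-1}\left(\frac{b^b}{a^a}\right)^{1/(b-a)}$; the Gauss compound mean is $$AGM(a,b)=\frac{\pi/2}{\int_0^{\pi/2}(a^2\cos^2\theta+b^2\sin^2\theta)^{-1/2}\,d\theta};$$ the Toader mean is $$\mathcal{T}(a,b)=\frac2\pi\int_0^{\pi/2}(a^2\cos^2\theta+b^2\sin^2\theta)^{1/2}\,d\theta;$$ the Toader-Qi mean is $$TQ(a,b)=\frac2\pi\int_0^{\pi/2}a^{\cos^2\theta}b^{\sin^2\theta}\,d\theta.$$ For a mean $M$ and $p\neq0$, the $p$-order mean is $M_p(a,b)=M(a^p,b^p)^{1/p}$; thus $\mathcal{T}_{1/3}(a,b)=\mathcal{T}(a^{1/3},b^{1/3})^{3}$ and $\mathcal{I}_{3/4}(a,b)=\mathcal{I}(a^{3/4},b^{3/4})^{4/3}$. *)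

(* Defs.v *)
From Stdlib Require Import Reals.
From Coquelicot Require Import Coquelicot.
Open Scope R_scope.

(* All means are total functions on R, meaningful for a, b > 0 with a <> b:
   [Rpower x y] is exp (y * ln x), i.e. x^y for x > 0 only, and for a, b > 0
   the integrands below are continuous, so [RInt] is their Riemann integral. *)

Definition log_mean (a b : R) : R := (b - a) / (ln b - ln a).

Definition arith_mean (a b : R) : R := (a + b) / 2.

Definition power_mean_half (a b : R) : R :=
  ((Rpower a (1 / 2) + Rpower b (1 / 2)) / 2) ^ 2.

Definition identric_mean (a b : R) : R :=
  / exp 1 * Rpower (Rpower b b / Rpower a a) (1 / (b - a)).

Definition AGM (a b : R) : R :=
  (PI / 2) /
  RInt (fun t => / sqrt (a ^ 2 * cos t ^ 2 + b ^ 2 * sin t ^ 2)) 0 (PI / 2).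

Definition toader_mean (a b : R) : R :=
  2 / PI *
  RInt (fun t => sqrt (a ^ 2 * cos t ^ 2 + b ^ 2 * sin t ^ 2)) 0 (PI / 2).

Definition toader_qi_mean (a b : R) : R :=
  2 / PI *
  RInt (fun t => Rpower a (cos t ^ 2) * Rpower b (sin t ^ 2)) 0 (PI / 2).

Definition order_mean (M : R -> R -> R) (p a b : R) : R :=
  Rpower (M (Rpower a p) (Rpower b p)) (1 / p).

(* Main.v *)
Require Import Defs.
From Stdlib Require Import Reals Psatz.
From Coquelicot Require Import Coquelicot.
Open Scope R_scope.

(** Write a = exp (m - t) and b = exp (m + t). Every mean in the chain is then
    exp m times an even function of t (for the two means of order p, after
    rescaling t and raising to a power), so it suffices to compare, for t > 0,
    elementary functions built from sinh t / t and cosh t with three integrals,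
    all equal to 1 at t = 0. With D = cosh 2t - sinh 2t cos 2y these integrals
    are the averages over y of exp (- t cos 2y), which is the Bessel
    function I_0 (t), and of D ^ nu, which is the Legendre function
    P_nu (cosh 2t); nu = - 1/2 gives the reciprocal of the AGM and nu = 1/2 the
    Toader mean.

    These integrals are known through their differential equations
      (t U')' = t U,
      (sinh 2t U')' = 4 nu (nu + 1) sinh 2t U,
    obtained by differentiating twice under the integral sign: the remainder
    is a total derivative in y ([bessel_flux], [legendre_flux]). An elementary
    F with F (0) = 1 satisfying the same equation with a strict inequality
    lies strictly on one side of U, because the Wronskian w (F' U - F U') is
    then monotone and vanishes at 0 ([sturm_comparison]).

    Each comparison with an integral is thereby reduced to a single inequality
    between polynomials in x, sinh x and cosh x, an equality at x = 0, which is
    settled by differentiating until the sign is visible. The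
    comparison with the identric mean also involves coth of two different
    multiples of t; these are related by [coth_lower_bound], which is sharp
    enough to leave exactly the hyperbolic Wilker inequality
    (x / sinh x) ^ 2 + x / tanh x > 2. The only step without an integral,
    between the arithmetic combination and the power mean, is the hyperbolic
    Cusa-Huygens inequality. *)

(** * Monotonicity and elementary hyperbolic inequalities *)

Lemma continuity_pt_of_is_derive (f : R -> R) (x l : R) :
  is_derive f x l -> continuity_pt f x.
Proof.
intros H. apply derivable_continuous_pt. exists l. now apply is_derive_Reals.
Qed.

Lemma is_derive_ext_pos (f g : R -> R) (t l : R) : 0 < t ->
  (forall x, 0 < x -> f x = g x) -> is_derive f t l -> is_derive g t l.
Proof.
intros Ht Hfg. apply is_derive_ext_loc.
exists (mkposreal t Ht). intros y Hy. apply Hfg.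
unfold ball in Hy; simpl in Hy; unfold AbsRing_ball, abs, minus, plus, opp
  in Hy; simpl in Hy.
apply Rabs_def2 in Hy. lra.
Qed.

(** Stated for functions that are merely continuous at 0, in order to cover
    expressions in sinh t / t and quotients by weights vanishing at 0. *)
Lemma increasing_from_zero (f df : R -> R) :
  continuity_pt f 0 ->
  (forall x, 0 < x -> is_derive f x (df x)) ->
  (forall x, 0 < x -> 0 < df x) ->
  forall x, 0 < x -> f 0 < f x.
Proof.
intros Hc Hd Hp x Hx.
(* The mean value point may be the endpoint 0, where df is arbitrary; the
   value 1 keeps the slope positive there. *)
destruct (MVT_gen f 0 x (fun y => if Rlt_dec 0 y then df y else 1))
  as [c [_ Hfc]].
- rewrite Rmin_left, Rmax_right by lra. intros y Hy.
  destruct (Rlt_dec 0 y); [apply Hd|]; lra.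
- rewrite Rmin_left, Rmax_right by lra. intros y Hy.
  destruct (Req_dec y 0) as [->|Hy0]; [exact Hc|].
  apply continuity_pt_of_is_derive with (df y). apply Hd; lra.
- cut (0 < (if Rlt_dec 0 c then df c else 1) * (x - 0)); [lra|].
  apply Rmult_lt_0_compat; [|lra].
  destruct (Rlt_dec 0 c); [now apply Hp|lra].
Qed.

Lemma positive_by_derivative (f df : R -> R) :
  (forall x, is_derive f x (df x)) -> 0 <= f 0 ->
  (forall x, 0 < x -> 0 < df x) -> forall x, 0 < x -> 0 < f x.
Proof.
intros Hd H0 Hp x Hx.
apply Rle_lt_trans with (f 0); [exact H0|].
apply increasing_from_zero with df; auto.
apply continuity_pt_of_is_derive with (df 0); auto.
Qed.

Lemma cosh_sqr x : cosh x ^ 2 = 1 + sinh x ^ 2.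
Proof.
unfold cosh, sinh. rewrite exp_Ropp. field. apply Rgt_not_eq, exp_pos.
Qed.

Lemma cosh_pos x : 0 < cosh x.
Proof.
unfold cosh; pose proof (exp_pos x); pose proof (exp_pos (- x)); lra.
Qed.

Lemma sinh_pos x : 0 < x -> 0 < sinh x.
Proof. intros H. rewrite <- sinh_0. now apply sinh_lt. Qed.

Lemma cosh_gt_one x : 0 < x -> 1 < cosh x.
Proof.
intros H. pose proof (cosh_sqr x). pose proof (sinh_pos x H).
pose proof (cosh_pos x). nra.
Qed.

Lemma sinh_double x : sinh (2 * x) = 2 * sinh x * cosh x.
Proof.
unfold cosh, sinh. replace (- (2 * x)) with (- x + - x) by ring.
replace (2 * x) with (x + x) by ring. rewrite !exp_plus. field.
Qed.

Lemma cosh_double x : cosh (2 * x) = 1 + 2 * sinh x ^ 2.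
Proof.
replace (1 + 2 * sinh x ^ 2) with (cosh x ^ 2 + sinh x ^ 2)
  by (rewrite cosh_sqr; ring).
unfold cosh, sinh. replace (- (2 * x)) with (- x + - x) by ring.
replace (2 * x) with (x + x) by ring. rewrite !exp_plus. field.
Qed.

(** Reduces the positivity of a function on the half-line to that of its
    derivative g, the value at 0 being checked by evaluation. *)
Ltac by_derivative g :=
  apply (positive_by_derivative _ g);
  [ intro; auto_derive; [trivial | try ring]
  | rewrite ?Rmult_0_r, ?sinh_0, ?cosh_0; lra | ].

Lemma sinh_gt_id x : 0 < x -> x < sinh x.
Proof.
intros Hx. apply Rlt_0_minus. revert x Hx.
by_derivative (fun x => cosh x - 1).
intros x Hx. pose proof (cosh_gt_one x Hx). lra.
Qed.

Lemma cosh_gt_quadratic x : 0 < x -> 1 + x ^ 2 / 2 < cosh x.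
Proof.
intros Hx. apply Rlt_0_minus. revert x Hx.
by_derivative (fun x => sinh x - x).
{ simpl; field. }
intros x Hx. pose proof (sinh_gt_id x Hx). lra.
Qed.

Lemma sinh_lt_x_cosh x : 0 < x -> sinh x < x * cosh x.
Proof.
intros Hx. apply Rlt_0_minus. revert x Hx.
by_derivative (fun x => x * sinh x).
intros x Hx. apply Rmult_lt_0_compat; auto using sinh_pos.
Qed.

(** The difference has a zero of order six at 0. After four derivatives the
    expression is bounded below, using x < sinh x and x ^ 2 < 2 (cosh x - 1),
    by 2 (7 cosh x - 1) (cosh x - 1). *)
Lemma hyperbolic_ineq_agm_upper x : 0 < x ->
  (4 * cosh x + 5) * x ^ 2 < 3 * sinh x ^ 2 + 6 * x * sinh x.
Proof.
intros Hx. apply Rlt_0_minus. revert x Hx.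
by_derivative (fun x => 6 * sinh x * cosh x + 6 * sinh x + 6 * x * cosh x
   - 4 * x ^ 2 * sinh x - (8 * cosh x + 10) * x).
by_derivative (fun x => 6 * cosh x ^ 2 + 6 * sinh x ^ 2 + 4 * cosh x - 10
   - 10 * x * sinh x - 4 * x ^ 2 * cosh x).
by_derivative (fun x => 24 * sinh x * cosh x - 6 * sinh x - 18 * x * cosh x
   - 4 * x ^ 2 * sinh x).
by_derivative (fun x => 24 * cosh x ^ 2 + 24 * sinh x ^ 2 - 24 * cosh x
   - 26 * x * sinh x - 4 * x ^ 2 * cosh x).
intros x Hx. pose proof (cosh_sqr x). pose proof (cosh_gt_one x Hx).
pose proof (sinh_gt_id x Hx). pose proof (cosh_gt_quadratic x Hx).
assert (x * sinh x < sinh x ^ 2) by nra.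
assert (x ^ 2 * cosh x < 2 * (cosh x - 1) * cosh x)
  by (apply Rmult_lt_compat_r; lra).
assert (0 < (7 * cosh x - 1) * (cosh x - 1))
  by (apply Rmult_lt_0_compat; lra).
lra.
Qed.

(** The difference has a zero of order six at 0; the fourth derivative is
    positive because sinh x < x cosh x. *)
Lemma hyperbolic_ineq_bessel_lower x : 0 < x ->
  9 * sinh x ^ 2 < 3 * x ^ 2 + 4 * x * sinh x * cosh x + 2 * x * sinh x.
Proof.
intros Hx. apply Rlt_0_minus. revert x Hx.
by_derivative (fun x => 6 * x - 14 * sinh x * cosh x
   + 4 * x * (cosh x ^ 2 + sinh x ^ 2) + 2 * sinh x + 2 * x * cosh x).
by_derivative (fun x => 6 - 10 * (cosh x ^ 2 + sinh x ^ 2)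
   + 16 * x * sinh x * cosh x + 4 * cosh x + 2 * x * sinh x).
by_derivative (fun x => - 24 * sinh x * cosh x
   + 16 * x * (cosh x ^ 2 + sinh x ^ 2) + 6 * sinh x + 2 * x * cosh x).
by_derivative (fun x => - 8 * (cosh x ^ 2 + sinh x ^ 2)
   + 64 * x * sinh x * cosh x + 8 * cosh x + 2 * x * sinh x).
intros x Hx. pose proof (cosh_sqr x). pose proof (cosh_gt_one x Hx).
pose proof (sinh_pos x Hx). pose proof (sinh_lt_x_cosh x Hx).
assert (sinh x * sinh x < sinh x * (x * cosh x))
  by (apply Rmult_lt_compat_l; lra).
assert (0 < x * sinh x) by (apply Rmult_lt_0_compat; lra).
assert (0 < sinh x * sinh x) by (apply Rmult_lt_0_compat; lra).
lra.
Qed.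

Lemma hyperbolic_ineq_bessel_upper x : 0 < x ->
  3 * x * cosh x < (x ^ 2 + 3) * sinh x.
Proof.
intros Hx. apply Rlt_0_minus. revert x Hx.
by_derivative (fun x => x * (x * cosh x - sinh x)).
intros x Hx. pose proof (sinh_lt_x_cosh x Hx).
apply Rmult_lt_0_compat; lra.
Qed.

(** The hyperbolic Cusa-Huygens inequality sinh x / x < (2 + cosh x) / 3. *)
Lemma cusa_huygens_hyperbolic x : 0 < x -> 3 * sinh x < x * (2 + cosh x).
Proof.
intros Hx. apply Rlt_0_minus. revert x Hx.
by_derivative (fun x => 2 - 2 * cosh x + x * sinh x).
by_derivative (fun x => x * cosh x - sinh x).
intros x Hx. pose proof (sinh_lt_x_cosh x Hx). lra.
Qed.

(** The hyperbolic Wilker inequality 2 < (x / sinh x) ^ 2 + x / tanh x. *)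
Lemma wilker_hyperbolic x : 0 < x ->
  2 * sinh x ^ 2 < x ^ 2 + x * sinh x * cosh x.
Proof.
intros Hx. apply Rlt_0_minus. revert x Hx.
by_derivative (fun x => 2 * x - 3 * sinh x * cosh x
    + x * (cosh x ^ 2 + sinh x ^ 2)).
by_derivative (fun x => 2 - 2 * (cosh x ^ 2 + sinh x ^ 2)
    + 4 * x * sinh x * cosh x).
intros x Hx. rewrite cosh_sqr.
pose proof (sinh_pos x Hx). pose proof (sinh_lt_x_cosh x Hx).
assert (sinh x * sinh x < sinh x * (x * cosh x))
  by (apply Rmult_lt_compat_l; lra).
lra.
Qed.

Lemma cosh_incr x y : 0 < x -> x < y -> cosh x < cosh y.
Proof.
intros Hx Hxy. pose proof (sinh_lt x y Hxy). pose proof (sinh_pos x Hx).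
pose proof (cosh_sqr x). pose proof (cosh_sqr y).
pose proof (cosh_pos x). pose proof (cosh_pos y). nra.
Qed.

(** Convexity of sinh on the half-line. *)
Lemma sinh_sub_linear (k x : R) : 0 < k < 1 -> 0 < x ->
  sinh (k * x) < k * sinh x.
Proof.
intros Hk Hx. apply Rlt_0_minus. revert x Hx.
by_derivative (fun x => k * (cosh x - cosh (k * x))).
intros x Hx. apply Rmult_lt_0_compat; [lra|].
assert (cosh (k * x) < cosh x) by (apply cosh_incr; nra). lra.
Qed.

(** * Sturm comparison for first-order systems in flux form *)

(** The second-order equation (w F')' = p written as a system for F and its
    flux P = w F'. Keeping P as a function of its own allows the weight w to
    vanish at 0, where the quotient P / w says nothing about F'. *)
Record flux_system (w F P p : R -> R) : Prop := {
  flux_F0 : F 0 = 1;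
  flux_P0 : P 0 = 0;
  flux_F_cont : continuity_pt F 0;
  flux_P_cont : continuity_pt P 0;
  flux_F_pos : forall t, 0 < t -> 0 < F t;
  flux_dF : forall t, 0 < t -> is_derive F t (P t / w t);
  flux_dP : forall t, 0 < t -> is_derive P t (p t) }.

(** The Wronskian W = P U - F V = w (F' U - F U') vanishes at 0 and has
    derivative p U - F v > 0. Hence W > 0, and F / U, whose derivative is
    W / (w U ^ 2), increases from the value 1. *)
Lemma sturm_comparison (w F P p U V v : R -> R) :
  (forall t, 0 < t -> 0 < w t) ->
  flux_system w F P p -> flux_system w U V v ->
  (forall t, 0 < t -> F t * v t < p t * U t) ->
  forall t, 0 < t -> U t < F t.
Proof.
intros Hw [F0 P0 Fc Pc Fp dF dP] [HU0 HV0 Uc Vc HUpos dU dV] Hlt.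
pose (W := fun t => P t * U t - F t * V t).
assert (HW : forall t, 0 < t -> 0 < W t).
{ intros t Ht. replace 0 with (W 0) by (unfold W; rewrite P0, HV0; ring).
  apply increasing_from_zero with (fun t => p t * U t - F t * v t); auto.
  - apply continuity_pt_minus; apply continuity_pt_mult; auto.
  - intros x Hx.
    replace (p x * U x - F x * v x) with
      ((p x * U x + P x * (V x / w x)) - (P x / w x * V x + F x * v x))
      by (field; apply Rgt_not_eq, Hw, Hx).
    apply (is_derive_minus (fun t => P t * U t) (fun t => F t * V t));
      apply (is_derive_mult (K := R_AbsRing)); auto; intros; apply Rmult_comm.
  - intros x Hx. specialize (Hlt x Hx). lra. }
intros t Ht.
assert (HR : F 0 / U 0 < F t / U t).
{ apply (increasing_from_zero (fun t => F t / U t)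
    (fun t => W t / (w t * U t ^ 2))); auto.
  - apply continuity_pt_div; auto. rewrite HU0. lra.
  - intros x Hx. pose proof (HUpos x Hx). pose proof (Hw x Hx).
    replace (W x / (w x * U x ^ 2)) with
      ((P x / w x * U x - F x * (V x / w x)) / U x ^ 2)
      by (unfold W; field; lra).
    apply is_derive_div; auto. lra.
  - intros x Hx. pose proof (HUpos x Hx). pose proof (Hw x Hx).
    apply Rdiv_lt_0_compat; [now apply HW|].
    apply Rmult_lt_0_compat; [|apply pow_lt]; auto. }
rewrite F0, HU0 in HR. specialize (HUpos t Ht).
apply Rlt_div_r in HR; lra.
Qed.

(** A comparison function is easiest to handle through its logarithm psi:
    with Q = w psi', the flux of exp psi is Q exp psi, and the derivative of
    the flux is (Q' + Q ^ 2 / w) exp psi. *)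
Lemma flux_system_exp (w psi Q q : R -> R) :
  psi 0 = 0 -> Q 0 = 0 -> continuity_pt psi 0 -> continuity_pt Q 0 ->
  (forall t, 0 < t -> is_derive psi t (Q t / w t)) ->
  (forall t, 0 < t -> is_derive Q t (q t)) ->
  flux_system w (fun t => exp (psi t)) (fun t => Q t * exp (psi t))
    (fun t => (q t + Q t * (Q t / w t)) * exp (psi t)).
Proof.
intros psi0 Q0 psic Qc dpsi dQ.
assert (Hc : continuity_pt (fun t => exp (psi t)) 0).
{ apply (continuity_pt_comp psi exp); auto.
  apply derivable_continuous_pt, derivable_pt_exp. }
assert (Hd : forall t, 0 < t ->
  is_derive (fun t => exp (psi t)) t (Q t / w t * exp (psi t))).
{ intros t Ht.
  exact (is_derive_comp exp psi t _ _ (is_derive_exp (psi t)) (dpsi t Ht)). }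
split; auto.
- rewrite psi0. apply exp_0.
- rewrite Q0. ring.
- apply continuity_pt_mult; auto.
- intros t _. apply exp_pos.
- intros t Ht. replace (Q t * exp (psi t) / w t) with (Q t / w t * exp (psi t))
    by (unfold Rdiv; ring). auto.
- intros t Ht.
  replace ((q t + Q t * (Q t / w t)) * exp (psi t)) with
    (q t * exp (psi t) + Q t * (Q t / w t * exp (psi t))) by ring.
  apply (is_derive_mult (K := R_AbsRing) Q (fun t => exp (psi t))); auto.
  intros; apply Rmult_comm.
Qed.

(** The continuous extension of sinh t / t, the normalized logarithmic mean. *)
Definition sinhc (t : R) : R := if Req_EM_T t 0 then 1 else sinh t / t.

Lemma sinhc_0 : sinhc 0 = 1.
Proof. unfold sinhc. destruct (Req_EM_T 0 0); lra. Qed.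

Lemma sinhc_pos_eq t : 0 < t -> sinhc t = sinh t / t.
Proof. intros H. unfold sinhc. destruct (Req_EM_T t 0); lra. Qed.

Lemma sinhc_pos t : 0 < t -> 0 < sinhc t.
Proof.
intros H. rewrite sinhc_pos_eq by exact H.
apply Rdiv_lt_0_compat; auto using sinh_pos.
Qed.

Lemma sinhc_continuous : continuity_pt sinhc 0.
Proof.
intros eps Heps.
destruct (derivable_pt_lim_sinh 0 eps Heps) as [d Hd].
exists d. split; [apply cond_pos|].
intros x [[_ Hx] Hxd].
unfold dist in *; simpl in *; unfold Rdist in *.
rewrite sinhc_0. unfold sinhc. destruct (Req_EM_T x 0) as [->|_]; [lra|].
rewrite Rminus_0_r in Hxd.
specialize (Hd x (not_eq_sym Hx) Hxd).
now rewrite Rplus_0_l, sinh_0, Rminus_0_r, cosh_0 in Hd.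
Qed.

Lemma is_derive_sinhc t : 0 < t ->
  is_derive sinhc t ((cosh t - sinhc t) / t).
Proof.
intros Ht.
apply is_derive_ext_pos with (fun x => sinh x / x); [exact Ht| |].
- intros x Hx. symmetry. now apply sinhc_pos_eq.
- rewrite sinhc_pos_eq by exact Ht. auto_derive; [lra|]. field. lra.
Qed.

(** * Integral means as solutions of Bessel and Legendre equations *)

Lemma continuous_slice (f : R -> R -> R) (x y : R) :
  continuity_2d_pt f x y -> continuous (f x) y.
Proof.
intros H. apply continuity_pt_filterlim.
intros eps Heps. destruct (H (mkposreal eps Heps)) as [d Hd].
exists d. split; [apply cond_pos|]. intros z [_ Hz].
apply Hd; [rewrite Rminus_diag, Rabs_R0; apply cond_pos|exact Hz].
Qed.

Lemma ex_RInt_slice (f : R -> R -> R) (x a b : R) :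
  (forall y, continuity_2d_pt f x y) -> ex_RInt (f x) a b.
Proof.
intros H. apply (ex_RInt_continuous (V := R_CompleteNormedModule)).
intros y _. now apply continuous_slice.
Qed.

Lemma is_derive_RInt_slice (f g : R -> R -> R) (a b t : R) :
  (forall s y, is_derive (fun s => f s y) s (g s y)) ->
  (forall s y, continuity_2d_pt f s y) ->
  (forall s y, continuity_2d_pt g s y) ->
  is_derive (fun s => RInt (f s) a b) t (RInt (g t) a b).
Proof.
intros Hd Hf Hg.
rewrite (RInt_ext (g t) (fun y => Derive (fun s => f s y) t)).
- apply (is_derive_RInt_param f).
  + apply filter_forall. intros s y _. exists (g s y). apply Hd.
  + intros y _. apply continuity_2d_pt_ext with g; [|apply Hg].
    intros s z. symmetry. apply is_derive_unique, Hd.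
  + apply filter_forall. intros s. apply ex_RInt_slice, Hf.
- intros y _. symmetry. apply is_derive_unique, Hd.
Qed.

Definition mean_value (u : R -> R -> R) (t : R) : R :=
  2 / PI * RInt (u t) 0 (PI / 2).

(** The average U of u over [0, PI/2] solves (w U')' = k w U as soon as
    (w u')' - k w u is the y-derivative of some B vanishing at both ends of the
    interval, for then the defect integrates to 0. *)
Lemma integral_flux_system (k : R) (w w1 : R -> R) (u ut utt B : R -> R -> R) :
  (forall s y, is_derive (fun s => u s y) s (ut s y)) ->
  (forall s y, is_derive (fun s => ut s y) s (utt s y)) ->
  (forall s y, continuity_2d_pt u s y) ->
  (forall s y, continuity_2d_pt ut s y) ->
  (forall s y, continuity_2d_pt utt s y) ->
  (forall s, is_derive w s (w1 s)) -> w 0 = 0 ->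
  (forall t, 0 < t -> 0 < w t) ->
  (forall s y, is_derive (B s) y
     (w1 s * ut s y + w s * utt s y - k * w s * u s y)) ->
  (forall s, B s 0 = 0) -> (forall s, B s (PI / 2) = 0) ->
  (forall s y, 0 < u s y) -> (forall y, u 0 y = 1) ->
  flux_system w (mean_value u) (fun t => w t * mean_value ut t)
    (fun t => k * w t * mean_value u t).
Proof.
intros du dut cu cut cutt dw w0 wp dB B0 B1 up u0.
assert (HU : forall t, is_derive (mean_value u) t (mean_value ut t)).
{ intros t. apply is_derive_scal, is_derive_RInt_slice; auto. }
assert (HV : forall t, is_derive (mean_value ut) t (mean_value utt t)).
{ intros t. apply is_derive_scal, is_derive_RInt_slice; auto. }
pose proof PI_RGT_0 as Hpi.
split.
- unfold mean_value. rewrite (RInt_ext _ (fun _ => 1)) by (intros; apply u0).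
  rewrite RInt_const. unfold scal; simpl; unfold mult; simpl. field. lra.
- rewrite w0. ring.
- apply continuity_pt_of_is_derive with (1 := HU 0).
- apply continuity_pt_mult.
  + apply continuity_pt_of_is_derive with (1 := dw 0).
  + apply continuity_pt_of_is_derive with (1 := HV 0).
- intros t _. unfold mean_value. apply Rmult_lt_0_compat.
  + apply Rdiv_lt_0_compat; lra.
  + apply RInt_gt_0; [lra| intros; apply up|].
    intros. apply continuous_slice; auto.
- intros t Ht. replace (w t * mean_value ut t / w t) with (mean_value ut t)
    by (field; apply Rgt_not_eq, wp, Ht). apply HU.
- intros t Ht.
  replace (k * w t * mean_value u t) with
    (w1 t * mean_value ut t + w t * mean_value utt t).
  + apply (is_derive_mult (K := R_AbsRing) w (mean_value ut)); auto.
    intros; apply Rmult_comm.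
  + assert (HI : is_RInt
        (fun y => w1 t * ut t y + w t * utt t y - k * w t * u t y)
        0 (PI / 2) (minus (B t (PI / 2)) (B t 0))).
    { apply (is_RInt_derive (V := R_CompleteNormedModule)).
      - intros; apply dB.
      - intros y _.
        apply (continuous_minus (V := R_NormedModule)
          (fun y => w1 t * ut t y + w t * utt t y) (fun y => k * w t * u t y));
          [apply (continuous_plus (V := R_NormedModule)
            (fun y => w1 t * ut t y) (fun y => w t * utt t y))|].
        all: apply (continuous_scal_r (V := R_NormedModule));
          apply continuous_slice; auto. }
    rewrite B0, B1, minus_eq_zero in HI.
    assert (HJ : is_RInt
        (fun y => w1 t * ut t y + w t * utt t y - k * w t * u t y) 0 (PI / 2)
        (w1 t * RInt (ut t) 0 (PI / 2) + w t * RInt (utt t) 0 (PI / 2)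
          - k * w t * RInt (u t) 0 (PI / 2))).
    { apply (is_RInt_minus (V := R_NormedModule)
        (fun y => w1 t * ut t y + w t * utt t y)
        (fun y => k * w t * u t y)).
      apply (is_RInt_plus (V := R_NormedModule)
        (fun y => w1 t * ut t y) (fun y => w t * utt t y)).
      all: apply (is_RInt_scal (V := R_NormedModule)),
        (RInt_correct (V := R_CompleteNormedModule)), ex_RInt_slice; auto. }
    apply (is_RInt_unique (V := R_CompleteNormedModule)) in HI.
    apply (is_RInt_unique (V := R_CompleteNormedModule)) in HJ.
    rewrite HI in HJ. change (@zero _) with 0 in HJ.
    unfold mean_value.
    transitivity (2 / PI * (w1 t * RInt (ut t) 0 (PI / 2)
       + w t * RInt (utt t) 0 (PI / 2) - k * w t * RInt (u t) 0 (PI / 2))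
       + k * w t * (2 / PI * RInt (u t) 0 (PI / 2))); [ring|].
    rewrite <- HJ. ring.
Qed.

(** Splits a goal along the arithmetic operations and one-variable functions
    of the integrand. The constant case has to come first, since the patterns
    of the other cases also match constants. *)
Ltac continuity_2d :=
  repeat (
    lazymatch goal with
    | |- continuity_2d_pt (fun _ _ => ?c) _ _ =>
        apply (continuity_2d_pt_const _ _ c)
    | |- continuity_2d_pt (fun x y => @?f x y + @?g x y) _ _ =>
        apply (continuity_2d_pt_plus f g)
    | |- continuity_2d_pt (fun x y => @?f x y - @?g x y) _ _ =>
        apply (continuity_2d_pt_minus f g)
    | |- continuity_2d_pt (fun x y => @?f x y * @?g x y) _ _ =>
        apply (continuity_2d_pt_mult f g)
    | |- continuity_2d_pt (fun x y => @?f x y / @?g x y) _ _ =>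
        apply (continuity_2d_pt_mult f (fun x y => / g x y))
    | |- continuity_2d_pt (fun x y => - @?f x y) _ _ =>
        apply (continuity_2d_pt_opp f)
    | |- continuity_2d_pt (fun x y => / @?f x y) _ _ =>
        apply (continuity_2d_pt_inv f)
    | |- continuity_2d_pt (fun x _ => x) _ _ => apply continuity_2d_pt_id1
    | |- continuity_2d_pt (fun _ y => y) _ _ => apply continuity_2d_pt_id2
    | |- continuity_2d_pt (fun x y => ?h (@?f x y)) _ _ =>
        apply (continuity_1d_2d_pt_comp h f)
    end).

Definition bessel_kernel (t y : R) : R := exp (- t * cos (2 * y)).
Definition bessel_kernel1 (t y : R) : R :=
  - cos (2 * y) * bessel_kernel t y.
Definition bessel_kernel2 (t y : R) : R :=
  cos (2 * y) * cos (2 * y) * bessel_kernel t y.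

Lemma continuity_2d_bessel s y : continuity_2d_pt bessel_kernel s y.
Proof.
unfold bessel_kernel. continuity_2d.
- apply derivable_continuous_pt, derivable_pt_exp.
- apply continuity_cos.
Qed.

(** The equation (t U')' = t U of the modified Bessel function I_0: with
    e = exp (- t cos 2y), the defect (t e')' - t e equals
    - (cos 2y + t sin^2 2y) e = d/dy (- sin 2y e / 2). *)
Lemma bessel_flux :
  flux_system (fun t => t) (mean_value bessel_kernel)
    (fun t => t * mean_value bessel_kernel1 t)
    (fun t => 1 * t * mean_value bessel_kernel t).
Proof.
apply (integral_flux_system 1 (fun t => t) (fun _ => 1) bessel_kernel
  bessel_kernel1 bessel_kernel2
  (fun t y => - sin (2 * y) / 2 * bessel_kernel t y)).
- intros s y. unfold bessel_kernel1, bessel_kernel. auto_derive; trivial. ring.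
- intros s y. unfold bessel_kernel2, bessel_kernel1, bessel_kernel.
  auto_derive; trivial. ring.
- apply continuity_2d_bessel.
- intros s y. unfold bessel_kernel1. continuity_2d.
  + apply continuity_cos.
  + apply continuity_2d_bessel.
- intros s y. unfold bessel_kernel2. continuity_2d.
  1, 2: apply continuity_cos.
  apply continuity_2d_bessel.
- intros s. auto_derive; trivial.
- reflexivity.
- trivial.
- intros s y. unfold bessel_kernel2, bessel_kernel1, bessel_kernel.
  auto_derive; trivial.
  pose proof (sin2_cos2 (2 * y)) as H. unfold Rsqr in H.
  match goal with |- ?a = ?b => cut (a - b =
    s * exp (- s * cos (2 * y)) *
   (1 - (sin (2 * y) * sin (2 * y) + cos (2 * y) * cos (2 * y)))) end.
  + rewrite H. lra.
  + field.
- intros s. rewrite Rmult_0_r, sin_0. field.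
- intros s. replace (2 * (PI / 2)) with PI by field. rewrite sin_PI. field.
- intros s y. apply exp_pos.
- intros y. unfold bessel_kernel. rewrite Ropp_0, Rmult_0_l. apply exp_0.
Qed.

(** The quadratic form a^2 cos^2 y + b^2 sin^2 y for a = exp (- t) and
    b = exp t, and its derivative in t. The averages of its powers are Laplace
    integrals for the Legendre functions P_nu (cosh 2t). *)
Definition legendre_base (t y : R) : R :=
  cosh (2 * t) - sinh (2 * t) * cos (2 * y).
Definition legendre_base1 (t y : R) : R :=
  2 * sinh (2 * t) - 2 * cosh (2 * t) * cos (2 * y).
Definition legendre_kernel (nu t y : R) : R :=
  Rpower (legendre_base t y) nu.
Definition legendre_kernel1 (nu t y : R) : R :=
  nu * legendre_kernel nu t y * legendre_base1 t y / legendre_base t y.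
Definition legendre_kernel2 (nu t y : R) : R :=
  nu * legendre_kernel nu t y *
  ((nu - 1) * legendre_base1 t y * legendre_base1 t y
     / (legendre_base t y * legendre_base t y) + 4).

(** The form is a convex combination of exp (2 t) and exp (- 2 t). *)
Lemma legendre_base_pos t y : 0 < legendre_base t y.
Proof.
unfold legendre_base. pose proof (COS_bound (2 * y)).
pose proof (exp_pos (2 * t)). pose proof (exp_pos (- (2 * t))).
unfold cosh, sinh.
replace ((exp (2 * t) + exp (- (2 * t))) / 2 -
   (exp (2 * t) - exp (- (2 * t))) / 2 * cos (2 * y)) with
  (exp (2 * t) * ((1 - cos (2 * y)) / 2)
    + exp (- (2 * t)) * ((1 + cos (2 * y)) / 2)) by field.
nra.
Qed.

Lemma is_derive_legendre_base s y :
  is_derive (fun s => legendre_base s y) s (legendre_base1 s y).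
Proof. unfold legendre_base, legendre_base1. auto_derive; trivial. ring. Qed.

Lemma is_derive_legendre_base1 s y :
  is_derive (fun s => legendre_base1 s y) s (4 * legendre_base s y).
Proof. unfold legendre_base, legendre_base1. auto_derive; trivial. ring. Qed.

Lemma is_derive_legendre_kernel nu s y :
  is_derive (fun s => legendre_kernel nu s y) s (legendre_kernel1 nu s y).
Proof.
unfold legendre_kernel1, legendre_kernel, Rpower.
pose proof (legendre_base_pos s y).
pose proof (is_derive_legendre_base s y) as Hd.
auto_derive.
- repeat split; auto. now exists (legendre_base1 s y).
- replace (Derive _ _) with (legendre_base1 s y)
    by (symmetry; apply is_derive_unique; auto).
  field. lra.
Qed.

Lemma is_derive_legendre_kernel1 nu s y :
  is_derive (fun s => legendre_kernel1 nu s y) s (legendre_kernel2 nu s y).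
Proof.
unfold legendre_kernel1.
pose proof (legendre_base_pos s y).
pose proof (is_derive_legendre_base s y) as Hb.
pose proof (is_derive_legendre_base1 s y) as Hb1.
pose proof (is_derive_legendre_kernel nu s y) as Hk.
auto_derive.
- repeat split; try (eexists; eassumption). lra.
- replace (Derive (fun x => legendre_base x y) s) with (legendre_base1 s y)
    by (symmetry; apply is_derive_unique; auto).
  replace (Derive (fun x => legendre_base1 x y) s)
    with (4 * legendre_base s y)
    by (symmetry; apply is_derive_unique; auto).
  replace (Derive (fun x => legendre_kernel nu x y) s)
    with (legendre_kernel1 nu s y)
    by (symmetry; apply is_derive_unique; auto).
  unfold legendre_kernel2, legendre_kernel1. field. lra.
Qed.

Lemma continuity_2d_legendre_base s y : continuity_2d_pt legendre_base s y.
Proof.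
unfold legendre_base. continuity_2d; try apply continuity_cos;
  apply derivable_continuous_pt;
  auto using derivable_pt_cosh, derivable_pt_sinh.
Qed.

Lemma continuity_2d_legendre_base1 s y : continuity_2d_pt legendre_base1 s y.
Proof.
unfold legendre_base1. continuity_2d; try apply continuity_cos;
  apply derivable_continuous_pt;
  auto using derivable_pt_cosh, derivable_pt_sinh.
Qed.

Lemma continuity_2d_legendre_kernel nu s y :
  continuity_2d_pt (legendre_kernel nu) s y.
Proof.
unfold legendre_kernel, Rpower. continuity_2d.
- apply derivable_continuous_pt, derivable_pt_exp.
- apply derivable_continuous_pt. exists (/ legendre_base s y).
  apply derivable_pt_lim_ln, legendre_base_pos.
- apply continuity_2d_legendre_base.
Qed.

(** The Legendre equation. With D the quadratic form, C = cosh 2t, S = sinh 2t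
    and primes for derivatives in t, one has D'' = 4 D,
    D'^2 = 4 D^2 - 4 sin^2 2y and C D' = 2 S D - 2 cos 2y; these turn the
    defect (S (D ^ nu)')' - 4 nu (nu + 1) S D ^ nu into
    d/dy (- 2 nu sin 2y D ^ (nu - 1)). *)
Lemma legendre_flux nu :
  flux_system (fun t => sinh (2 * t)) (mean_value (legendre_kernel nu))
    (fun t => sinh (2 * t) * mean_value (legendre_kernel1 nu) t)
    (fun t => 4 * nu * (nu + 1) * sinh (2 * t)
       * mean_value (legendre_kernel nu) t).
Proof.
assert (Hb : forall s y, legendre_base s y <> 0)
  by (intros; apply Rgt_not_eq, legendre_base_pos).
apply (integral_flux_system (4 * nu * (nu + 1))
  (fun t => sinh (2 * t)) (fun t => 2 * cosh (2 * t)) (legendre_kernel nu)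
  (legendre_kernel1 nu) (legendre_kernel2 nu)
  (fun t y => - 2 * nu * sin (2 * y) * legendre_kernel nu t y
     / legendre_base t y)).
- apply is_derive_legendre_kernel.
- apply is_derive_legendre_kernel1.
- apply continuity_2d_legendre_kernel.
- intros s y. unfold legendre_kernel1. continuity_2d;
    auto using continuity_2d_legendre_kernel, continuity_2d_legendre_base,
      continuity_2d_legendre_base1.
- intros s y. unfold legendre_kernel2. continuity_2d;
    auto using continuity_2d_legendre_kernel, continuity_2d_legendre_base,
      continuity_2d_legendre_base1, Rmult_integral_contrapositive_currified.
- intros s. auto_derive; trivial. ring.
- rewrite Rmult_0_r. apply sinh_0.
- intros t Ht. apply sinh_pos. lra.
- intros s y. specialize (Hb s y). pose proof (legendre_base_pos s y).
  unfold legendre_kernel2, legendre_kernel1, legendre_kernel, Rpower.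
  set (C := cosh (2 * s)). set (S := sinh (2 * s)).
  assert (HCS : C ^ 2 = 1 + S ^ 2) by apply cosh_sqr.
  assert (HD : is_derive (legendre_base s) y (2 * S * sin (2 * y))).
  { unfold legendre_base. auto_derive; trivial. unfold S. ring. }
  auto_derive.
  + repeat split; auto; eexists; eassumption.
  + replace (Derive _ y) with (2 * S * sin (2 * y))
      by (symmetry; apply is_derive_unique; auto).
    set (E := exp _).
    assert (HB : legendre_base s y = C - S * cos (2 * y)) by reflexivity.
    assert (HB1 : legendre_base1 s y = 2 * S - 2 * C * cos (2 * y))
      by reflexivity.
    rewrite HB1.
    pose proof (sin2_cos2 (2 * y)) as H2. unfold Rsqr in H2.
    set (c := cos (2 * y)) in *. set (sn := sin (2 * y)) in *.
    set (D := legendre_base s y) in *.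
    set (T := 2 * S - 2 * C * c).
    assert (HCT : C * T = 2 * S * D - 2 * c).
    { transitivity (2 * S * (C - S * c) - 2 * c * (C ^ 2 - S ^ 2));
        [unfold T; ring | rewrite HB, HCS; ring]. }
    assert (HTT : T * T = 4 * D * D - 4 * sn * sn).
    { transitivity (4 * (C - S * c) * (C - S * c)
         - 4 * (C ^ 2 - S ^ 2) * (1 - c * c)); [unfold T; ring|].
      replace (1 - c * c) with (sn * sn) by lra. rewrite <- HB, HCS. ring. }
    transitivity (2 * nu * E * (C * T) / D
      + S * nu * E * ((nu - 1) * (T * T) / (D * D) + 4)
      - 4 * nu * (nu + 1) * S * E).
    * rewrite HCT, HTT. clearbody D. field. exact Hb.
    * clearbody D. field. exact Hb.
- intros s. rewrite Rmult_0_r, sin_0. unfold Rdiv. ring.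
- intros s. replace (2 * (PI / 2)) with PI by field. rewrite sin_PI.
  unfold Rdiv. ring.
- intros s y. apply exp_pos.
- intros y. unfold legendre_kernel, legendre_base.
  rewrite Rmult_0_r, cosh_0, sinh_0, Rmult_0_l, Rminus_0_r.
  unfold Rpower. now rewrite ln_1, Rmult_0_r, exp_0.
Qed.

(** * The inequalities between normalized means *)

(** The one-variable counterpart of [continuity_2d]; it leaves the conditions
    that denominators be nonzero and arguments of ln positive. *)
Ltac continuity_at :=
  repeat (
    lazymatch goal with
    | |- continuity_pt (fun _ => ?c) _ =>
        apply continuity_pt_const; intros ? ?; reflexivity
    | |- continuity_pt (fun x => x) _ =>
        apply derivable_continuous_pt, derivable_pt_id
    | |- continuity_pt (fun x => @?f x + @?g x) _ =>
        apply (continuity_pt_plus f g)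
    | |- continuity_pt (fun x => @?f x - @?g x) _ =>
        apply (continuity_pt_minus f g)
    | |- continuity_pt (fun x => @?f x * @?g x) _ =>
        apply (continuity_pt_mult f g)
    | |- continuity_pt (fun x => @?f x / @?g x) _ =>
        apply (continuity_pt_div f g)
    | |- continuity_pt (fun x => - @?f x) _ => apply (continuity_pt_opp f)
    | |- continuity_pt (fun x => / @?f x) _ => apply (continuity_pt_inv f)
    | |- continuity_pt (fun x => @?f x ^ 2) _ =>
        apply (continuity_pt_comp f (fun y => y ^ 2));
        [|apply derivable_continuous_pt, derivable_pt_pow]
    | |- continuity_pt cosh _ =>
        apply derivable_continuous_pt, derivable_pt_cosh
    | |- continuity_pt sinh _ =>
        apply derivable_continuous_pt, derivable_pt_sinh
    | |- continuity_pt ln _ => apply derivable_continuous_pt; eexists;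
        apply derivable_pt_lim_ln
    | |- continuity_pt sinhc _ =>
        rewrite ?Rmult_0_r; apply sinhc_continuous
    | |- continuity_pt (fun x => ?h x) _ => change (continuity_pt h 0)
    | |- continuity_pt (fun x => ?h (@?f x)) _ =>
        apply (continuity_pt_comp f h)
    end).

(** Evaluation at t = 0 of expressions in sinhc, cosh, sinh and ln. *)
Ltac at_zero :=
  rewrite ?Rmult_0_r, ?sinhc_0, ?cosh_0, ?sinh_0, ?ln_1; try lra.

Local Notation bessel_mean := (mean_value bessel_kernel).
Local Notation agm_recip := (mean_value (legendre_kernel (- (1 / 2)))).
Local Notation toader_norm := (mean_value (legendre_kernel (1 / 2))).

Lemma sinh_double_pos t : 0 < t -> 0 < sinh (2 * t).
Proof. intros. apply sinh_pos. lra. Qed.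

(** For F = t / sinh t the excess (sinh 2t F')' + sinh 2t F equals
    2 (t cosh t - sinh t) / sinh^2 t > 0. *)
Lemma agm_recip_lt_inv_sinhc t : 0 < t -> agm_recip t < / sinhc t.
Proof.
revert t.
pose proof (legendre_flux (- (1 / 2))) as HU.
refine (sturm_comparison _ _ (fun t => 2 * cosh t - 2 * cosh t ^ 2 / sinhc t)
  (fun t => 2 * sinh t - 4 * cosh t * sinh t / sinhc t
    + 2 * cosh t ^ 2 * (cosh t - sinhc t) / (t * sinhc t ^ 2))
  _ _ _ sinh_double_pos _ HU _).
- split.
  + rewrite sinhc_0. field.
  + at_zero.
  + continuity_at. at_zero.
  + continuity_at. at_zero.
  + intros t Ht. apply Rinv_0_lt_compat, sinhc_pos, Ht.
  + intros t Ht. pose proof (sinhc_pos t Ht). pose proof (sinh_pos t Ht).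
    pose proof (cosh_pos t).
    pose proof (is_derive_sinhc t Ht) as Hq.
    auto_derive.
    * split; [eexists; exact Hq|]. lra.
    * replace (Derive _ t) with ((cosh t - sinhc t) / t)
        by (symmetry; apply is_derive_unique; auto).
      rewrite sinh_double, sinhc_pos_eq by exact Ht. field. lra.
  + intros t Ht. pose proof (sinhc_pos t Ht).
    pose proof (is_derive_sinhc t Ht) as Hq.
    auto_derive.
    * split; [eexists; exact Hq|]. lra.
    * replace (Derive _ t) with ((cosh t - sinhc t) / t)
        by (symmetry; apply is_derive_unique; auto).
      field. lra.
- intros t Ht. pose proof (flux_F_pos _ _ _ _ HU t Ht) as HUp.
  pose proof (sinh_pos t Ht). pose proof (sinh_lt_x_cosh t Ht).
  pose proof (cosh_sqr t).
  match goal with |- ?a < ?b =>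
    replace a with ((- sinh (2 * t) / sinhc t) * agm_recip t)
      by (field; apply Rgt_not_eq, sinhc_pos, Ht) end.
  apply Rmult_lt_compat_r; [exact HUp|].
  apply Rlt_0_minus.
  rewrite sinh_double, sinhc_pos_eq by exact Ht.
  match goal with |- 0 < ?a =>
    replace a with (2 * (t * cosh t - sinh t) / sinh t ^ 2)
      by (field [H1]; lra) end.
  apply Rdiv_lt_0_compat; [lra|]. apply pow_lt; lra.
Qed.

(** The logarithm of the weighted geometric mean L ^ (3/4) A ^ (1/4) in
    normalized form. *)
Definition ln_geometric (t : R) : R :=
  3 / 4 * ln (sinhc t) + 1 / 4 * ln (cosh t).

Lemma is_derive_ln_geometric t : 0 < t ->
  is_derive ln_geometric t
   (3 / 4 * (cosh t / sinh t - 1 / t) + 1 / 4 * (sinh t / cosh t)).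
Proof.
intros Ht. unfold ln_geometric.
pose proof (sinhc_pos t Ht). pose proof (sinh_pos t Ht).
pose proof (cosh_pos t). pose proof (is_derive_sinhc t Ht) as Hq.
auto_derive.
- repeat split; auto. eexists; exact Hq.
- replace (Derive _ t) with ((cosh t - sinhc t) / t)
    by (symmetry; apply is_derive_unique; auto).
  rewrite sinhc_pos_eq by exact Ht. field. lra.
Qed.

Lemma ln_geometric_0 : ln_geometric 0 = 0.
Proof. unfold ln_geometric. at_zero. Qed.

Lemma ln_geometric_continuous : continuity_pt ln_geometric 0.
Proof. unfold ln_geometric. continuity_at; at_zero. Qed.

(** For F = exp (- psi) with psi as in [ln_geometric], the excess
    (sinh 2t F')' / F + sinh 2t is a negative multiple of the gap in
    [hyperbolic_ineq_agm_upper] at x = 2t. *)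
Lemma inv_geometric_lt_agm_recip t : 0 < t ->
  exp (- ln_geometric t) < agm_recip t.
Proof.
revert t.
pose proof (legendre_flux (- (1 / 2))) as HU.
refine (sturm_comparison _ _ _ _ _ _ _ sinh_double_pos HU
  (flux_system_exp (fun t => sinh (2 * t)) (fun t => - ln_geometric t)
   (fun t => - (3 / 2 * (cosh t ^ 2 - cosh t * sinhc t) + sinh t ^ 2 / 2))
   (fun t => - (3 / 2 * (2 * cosh t * sinh t - sinh t * sinhc t
      - cosh t * (cosh t - sinhc t) / t) + sinh t * cosh t)) _ _ _ _ _ _) _).
- rewrite ln_geometric_0. lra.
- at_zero.
- apply (continuity_pt_opp ln_geometric), ln_geometric_continuous.
- continuity_at. lra.
- intros t Ht. pose proof (sinhc_pos t Ht). pose proof (sinh_pos t Ht).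
  pose proof (cosh_pos t).
  match goal with |- is_derive _ _ ?l =>
   replace l with (- (3 / 4 * (cosh t / sinh t - 1 / t)
      + 1 / 4 * (sinh t / cosh t))) end.
  + apply (is_derive_opp ln_geometric), is_derive_ln_geometric, Ht.
  + rewrite sinh_double, sinhc_pos_eq by exact Ht. field. lra.
- intros t Ht. pose proof (is_derive_sinhc t Ht) as Hq.
  auto_derive.
  + eexists; exact Hq.
  + replace (Derive _ t) with ((cosh t - sinhc t) / t)
      by (symmetry; apply is_derive_unique; auto).
    field. lra.
- intros t Ht. pose proof (flux_F_pos _ _ _ _ HU t Ht) as HUp.
  pose proof (sinh_pos t Ht). pose proof (cosh_pos t).
  pose proof (cosh_sqr t).
  assert (Hh := hyperbolic_ineq_agm_upper (2 * t) ltac:(lra)).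
  rewrite cosh_double, sinh_double in Hh.
  (* Both sides carry the positive factor exp psi times the integral. *)
  match goal with |- ?a * (?b * ?e) < _ =>
    replace (a * (b * e)) with (b * (e * a)) by ring end.
  match goal with |- _ < ?c * ?a * ?e =>
    replace (c * a * e) with (c * (e * a)) by ring end.
  apply Rmult_lt_compat_r; [apply Rmult_lt_0_compat; auto using exp_pos|].
  apply Rlt_0_minus.
  rewrite sinh_double, sinhc_pos_eq by exact Ht.
  match goal with |- 0 < ?a =>
    replace a with ((3 * sinh t ^ 2 * cosh t ^ 2 + 6 * t * sinh t * cosh t
      - (9 + 8 * sinh t ^ 2) * t ^ 2) / (8 * sinh t * cosh t * t ^ 2))
      by (field [H1]; lra) end.
  apply Rdiv_lt_0_compat; [nra|].
  apply Rmult_lt_0_compat; [|apply pow_lt; lra].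
  apply Rmult_lt_0_compat; lra.
Qed.

(** For F = exp psi with psi as in [ln_geometric], the gap t - (t F')' / F is a
    positive multiple of the one in [hyperbolic_ineq_bessel_lower] at
    x = 2t. *)
Lemma geometric_lt_bessel_mean t : 0 < t ->
  exp (ln_geometric t) < bessel_mean t.
Proof.
revert t.
pose proof bessel_flux as HU.
refine (sturm_comparison _ _ _ _ _ _ _ _ HU
  (flux_system_exp (fun t => t) ln_geometric
   (fun t => 3 / 4 * (cosh t / sinhc t - 1) + t * sinh t / (4 * cosh t))
   (fun t => 3 / 4 * (sinh t / sinhc t
       - cosh t * (cosh t - sinhc t) / (t * sinhc t ^ 2))
     + sinh t / (4 * cosh t)
     + t * (cosh t ^ 2 - sinh t ^ 2) / (4 * cosh t ^ 2))
   _ _ _ _ _ _) _).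
- auto.
- apply ln_geometric_0.
- at_zero.
- apply ln_geometric_continuous.
- continuity_at; at_zero.
- intros t Ht. pose proof (sinh_pos t Ht). pose proof (cosh_pos t).
  match goal with |- is_derive _ _ ?l =>
   replace l with (3 / 4 * (cosh t / sinh t - 1 / t)
      + 1 / 4 * (sinh t / cosh t)) end.
  + apply is_derive_ln_geometric, Ht.
  + rewrite sinhc_pos_eq by exact Ht. field. lra.
- intros t Ht. pose proof (is_derive_sinhc t Ht) as Hq.
  pose proof (sinhc_pos t Ht). pose proof (cosh_pos t).
  auto_derive.
  + repeat split; try lra. eexists; exact Hq.
  + replace (Derive _ t) with ((cosh t - sinhc t) / t)
      by (symmetry; apply is_derive_unique; auto).
    field. lra.
- intros t Ht. pose proof (flux_F_pos _ _ _ _ HU t Ht) as HUp.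
  pose proof (sinh_pos t Ht). pose proof (cosh_pos t).
  pose proof (cosh_sqr t).
  assert (Hh := hyperbolic_ineq_bessel_lower (2 * t) ltac:(lra)).
  rewrite cosh_double, sinh_double in Hh.
  match goal with |- ?a * (?b * ?e) < _ =>
    replace (a * (b * e)) with (b * (e * a)) by ring end.
  match goal with |- _ < 1 * t * ?u * ?e =>
    replace (1 * t * u * e) with (t * (e * u)) by ring end.
  apply Rmult_lt_compat_r; [apply Rmult_lt_0_compat; auto using exp_pos|].
  apply Rlt_0_minus.
  rewrite sinhc_pos_eq by exact Ht.
  match goal with |- 0 < ?a =>
    replace a with ((3 * t ^ 2 + 2 * t * sinh t * cosh t
        * (3 * cosh t ^ 2 + sinh t ^ 2)
        - 9 * sinh t ^ 2 * cosh t ^ 2)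
        / (16 * t * (sinh t ^ 2 * cosh t ^ 2)))
      by (field [H1]; lra) end.
  apply Rdiv_lt_0_compat; [rewrite H1 at 1; nra|].
  apply Rmult_lt_0_compat; [lra|].
  apply Rmult_lt_0_compat; apply pow_lt; lra.
Qed.

(** For F = 3/4 sinh t / t + 1/4 cosh t the excess (t F')' - t F equals
    ((t ^ 2 + 3) sinh t - 3 t cosh t) / (4 t ^ 2). *)
Lemma bessel_mean_lt_arithmetic t : 0 < t ->
  bessel_mean t < 3 / 4 * sinhc t + 1 / 4 * cosh t.
Proof.
revert t.
pose proof bessel_flux as HU.
refine (sturm_comparison _ _
  (fun t => 3 / 4 * (cosh t - sinhc t) + t * sinh t / 4)
  (fun t => 3 / 4 * (sinh t - (cosh t - sinhc t) / t)
    + sinh t / 4 + t * cosh t / 4)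
  _ _ _ _ _ HU _).
- auto.
- split.
  + at_zero.
  + at_zero.
  + continuity_at; at_zero.
  + continuity_at; at_zero.
  + intros t Ht. pose proof (sinhc_pos t Ht). pose proof (cosh_pos t). lra.
  + intros t Ht. pose proof (is_derive_sinhc t Ht) as Hq.
    auto_derive.
    * eexists; exact Hq.
    * replace (Derive _ t) with ((cosh t - sinhc t) / t)
        by (symmetry; apply is_derive_unique; auto).
      field. lra.
  + intros t Ht. pose proof (is_derive_sinhc t Ht) as Hq.
    auto_derive.
    * eexists; exact Hq.
    * replace (Derive _ t) with ((cosh t - sinhc t) / t)
        by (symmetry; apply is_derive_unique; auto).
      field. lra.
- intros t Ht. pose proof (flux_F_pos _ _ _ _ HU t Ht) as HUp.
  pose proof (hyperbolic_ineq_bessel_upper t Ht).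
  match goal with |- ?a * (1 * t * ?u) < _ =>
    replace (a * (1 * t * u)) with (t * a * u) by ring end.
  apply Rmult_lt_compat_r; [exact HUp|].
  apply Rlt_0_minus. rewrite sinhc_pos_eq by exact Ht.
  match goal with |- 0 < ?a =>
    replace a with (((t ^ 2 + 3) * sinh t - 3 * t * cosh t)
       * / (4 * t ^ 2)) by (field; lra) end.
  apply Rmult_lt_0_compat; [lra|].
  apply Rinv_0_lt_compat. nra.
Qed.

Lemma sinh_minus x y : sinh (x - y) = sinh x * cosh y - cosh x * sinh y.
Proof.
unfold sinh, cosh. replace (- (x - y)) with (- x + y) by ring.
replace (x - y) with (x + - y) by ring. rewrite !exp_plus. field.
Qed.

(** With F = cosh (3t/2) ^ (2/3), the inequality (sinh 2t F')' < 3 sinh 2t F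
    amounts to 2 sinh (3t - 2t) < sinh 2t, that is 1 < cosh t. *)
Lemma power_mean_lt_toader t : 0 < t ->
  exp (2 / 3 * ln (cosh (3 / 2 * t))) < toader_norm t.
Proof.
revert t.
pose proof (legendre_flux (1 / 2)) as HU.
refine (sturm_comparison _ _ _ _ _ _ _ sinh_double_pos HU
  (flux_system_exp (fun t => sinh (2 * t))
   (fun t => 2 / 3 * ln (cosh (3 / 2 * t)))
   (fun t => sinh (2 * t) * sinh (3 / 2 * t) / cosh (3 / 2 * t))
   (fun t => 2 * cosh (2 * t) * sinh (3 / 2 * t) / cosh (3 / 2 * t)
    + sinh (2 * t) * (3 / 2)
       * (cosh (3 / 2 * t) ^ 2 - sinh (3 / 2 * t) ^ 2)
       / cosh (3 / 2 * t) ^ 2)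
   _ _ _ _ _ _) _).
- at_zero.
- at_zero.
- continuity_at; at_zero.
- continuity_at; at_zero.
- intros t Ht. pose proof (sinh_double_pos t Ht).
  pose proof (cosh_pos (3 / 2 * t)). auto_derive; [auto|]. field. lra.
- intros t Ht. pose proof (cosh_pos (3 / 2 * t)).
  auto_derive; [lra|]. field. lra.
- intros t Ht. pose proof (flux_F_pos _ _ _ _ HU t Ht) as HUp.
  pose proof (sinh_double_pos t Ht).
  pose proof (sinh_pos t Ht). pose proof (cosh_gt_one t Ht).
  pose proof (cosh_pos (3 / 2 * t)) as Hc.
  pose proof (cosh_sqr (3 / 2 * t)) as Hs.
  assert (Hm : sinh t = sinh (3 * t) * cosh (2 * t)
    - cosh (3 * t) * sinh (2 * t)).
  { rewrite <- sinh_minus. f_equal. ring. }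
  replace (3 * t) with (2 * (3 / 2 * t)) in Hm by field.
  rewrite (sinh_double (3 / 2 * t)), (cosh_double (3 / 2 * t)) in Hm.
  match goal with |- ?a * (?b * ?e) < ?k * ?w * _ * _ =>
    replace (a * (b * e)) with (b * (e * a)) by ring;
    replace (k * w * a * e) with ((k * w) * (e * a)) by ring end.
  apply Rmult_lt_compat_r; [apply Rmult_lt_0_compat; auto using exp_pos|].
  apply Rlt_0_minus.
  match goal with |- 0 < ?a =>
    replace a with ((sinh (2 * t) * (3 / 2 + 2 * sinh (3 / 2 * t) ^ 2)
        - 2 * cosh (2 * t) * sinh (3 / 2 * t) * cosh (3 / 2 * t))
        / cosh (3 / 2 * t) ^ 2)
      by (field [Hs]; lra) end.
  apply Rdiv_lt_0_compat; [|apply pow_lt; lra].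
  assert (sinh t < sinh t * cosh t) by nra.
  rewrite (sinh_double t) in *. lra.
Qed.

(** In the form coth (8s/9) > coth s + s / (8 sinh^2 s). By the subtraction
    formula coth (8s/9) - coth s = sinh (s/9) / (sinh (8s/9) sinh s), where
    sinh (s/9) > s/9 and sinh (8s/9) < 8/9 sinh s. *)
Lemma coth_lower_bound s : 0 < s ->
  sinh (8 / 9 * s) * (8 * cosh s * sinh s + s)
    < 8 * sinh s ^ 2 * cosh (8 / 9 * s).
Proof.
intros Hs. pose proof (sinh_pos s Hs).
pose proof (sinh_sub_linear (8 / 9) s ltac:(lra) Hs).
pose proof (sinh_gt_id (s / 9) ltac:(lra)).
assert (Hm : sinh (s / 9) = sinh s * cosh (8 / 9 * s)
  - cosh s * sinh (8 / 9 * s)).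
{ rewrite <- sinh_minus. f_equal. field. }
assert (sinh s * (s / 9) < sinh s * sinh (s / 9))
  by (apply Rmult_lt_compat_l; lra).
assert (sinh (8 / 9 * s) * s < 8 / 9 * sinh s * s)
  by (apply Rmult_lt_compat_r; lra).
rewrite Hm in *. lra.
Qed.

(** Put s = 9t/4, so that 2t = 8s/9, and F = exp (4/9 (s coth s - 1)); then
    p = F' / F = coth s - s / sinh^2 s. The required inequality is
    2 coth (8s/9) p + 9/2 (s coth s - 1) / sinh^2 s + p ^ 2 > 3. Since
    p > 0, replacing coth (8s/9) by the bound of [coth_lower_bound] decreases
    the left side, whose excess over 3 becomes
    3/4 (s coth s + s^2 / sinh^2 s - 2) / sinh^2 s. This is positive by
    [wilker_hyperbolic]. *)
Lemma toader_lt_identric t : 0 < t ->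
  toader_norm t < exp (4 / 9 * (cosh (9 / 4 * t) / sinhc (9 / 4 * t) - 1)).
Proof.
revert t.
pose proof (legendre_flux (1 / 2)) as HU.
refine (sturm_comparison _ _ _ _ _ _ _ sinh_double_pos
  (flux_system_exp (fun t => sinh (2 * t))
   (fun t => 4 / 9 * (cosh (9 / 4 * t) / sinhc (9 / 4 * t) - 1))
   (fun t => 8 / 9 * (sinhc (2 * t) / sinhc (9 / 4 * t))
     * (cosh (9 / 4 * t) - / sinhc (9 / 4 * t)))
   (fun t => 2 * cosh (2 * t) * (cosh (9 / 4 * t) / sinh (9 / 4 * t)
       - 9 / 4 * t / sinh (9 / 4 * t) ^ 2)
     + sinh (2 * t) * (9 / 2) * (9 / 4 * t * cosh (9 / 4 * t)
        - sinh (9 / 4 * t)) / sinh (9 / 4 * t) ^ 3)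
   _ _ _ _ _ _) HU _).
- at_zero.
- at_zero.
- continuity_at; at_zero.
- continuity_at; at_zero.
- intros t Ht. pose proof (sinh_double_pos t Ht).
  pose proof (sinh_pos (9 / 4 * t) ltac:(lra)).
  pose proof (cosh_sqr (9 / 4 * t)) as Hs.
  apply is_derive_ext_pos with
    (fun t => 4 / 9 * (9 / 4 * t * cosh (9 / 4 * t) / sinh (9 / 4 * t) - 1));
    [exact Ht| |].
  + intros x Hx. pose proof (sinh_pos (9 / 4 * x) ltac:(lra)).
    rewrite sinhc_pos_eq by lra. field. lra.
  + rewrite !sinhc_pos_eq by lra. auto_derive; [lra|]. field [Hs]. lra.
- intros t Ht. pose proof (sinh_pos (9 / 4 * t) ltac:(lra)).
  pose proof (cosh_sqr (9 / 4 * t)) as Hs.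
  apply is_derive_ext_pos with
    (fun t => sinh (2 * t) * (cosh (9 / 4 * t) / sinh (9 / 4 * t)
       - 9 / 4 * t / sinh (9 / 4 * t) ^ 2)); [exact Ht| |].
  + intros x Hx. pose proof (sinh_pos (9 / 4 * x) ltac:(lra)).
    rewrite !sinhc_pos_eq by lra. field. lra.
  + auto_derive.
    * assert (sinh (9 / 4 * t) ^ 2 <> 0) by (apply pow_nonzero; lra).
      repeat split; lra.
    * field [Hs]. lra.
- intros t Ht. pose proof (flux_F_pos _ _ _ _ HU t Ht) as HUp.
  match goal with |- ?e * (?k * ?w * ?u) < (?q + ?Q * (?Q / ?w)) * ?e * ?u =>
    replace (e * (k * w * u)) with ((k * w) * (e * u)) by ring;
    replace ((q + Q * (Q / w)) * e * u) with ((q + Q * (Q / w)) * (e * u))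
      by ring end.
  apply Rmult_lt_compat_r; [apply Rmult_lt_0_compat; auto using exp_pos|].
  pose proof (sinh_double_pos t Ht) as HW.
  rewrite !sinhc_pos_eq by lra.
  remember (9 / 4 * t) as s eqn:Es.
  assert (Hs : 0 < s) by lra.
  (* From here on s is the variable, and W, K are sinh and cosh of 8s/9. *)
  replace t with (4 / 9 * s) in * by lra.
  pose proof (coth_lower_bound s Hs) as Hb.
  replace (8 / 9 * s) with (2 * (4 / 9 * s)) in Hb by field.
  pose proof (wilker_hyperbolic s Hs) as H7.
  pose proof (cosh_sqr s) as Hcs.
  pose proof (sinh_gt_id s Hs). pose proof (cosh_gt_one s Hs).
  set (W := sinh (2 * (4 / 9 * s))) in *.
  set (K := cosh (2 * (4 / 9 * s))) in *.
  set (S := sinh s) in *. set (C := cosh s) in *.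
  (* The derivative p of ln F is (S C - s) / S^2, hence positive. *)
  assert (HSC : s < S * C) by nra.
  apply Rlt_0_minus.
  match goal with |- 0 < ?a => replace a with
    ((S * C - s) * (8 * S ^ 2 * K - W * (8 * C * S + s)) / (4 * S ^ 4)
     + 3 * W * (s ^ 2 + s * S * C - 2 * S ^ 2) / (4 * S ^ 4))
    by (field [Hcs]; lra) end.
  assert (0 < S ^ 4) by (apply pow_lt; lra).
  apply Rplus_lt_0_compat; apply Rdiv_lt_0_compat;
    try apply Rmult_lt_0_compat; lra.
Qed.

(** * Exponential coordinates *)

Lemma cosh_opp t : cosh (- t) = cosh t.
Proof. unfold cosh. rewrite Ropp_involutive. lra. Qed.

Lemma sinh_opp t : sinh (- t) = - sinh t.
Proof. unfold sinh. rewrite Ropp_involutive. lra. Qed.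

Lemma sinhc_opp t : sinhc (- t) = sinhc t.
Proof.
unfold sinhc. rewrite sinh_opp.
destruct (Req_EM_T (- t) 0), (Req_EM_T t 0); try lra. field. lra.
Qed.

(** The reflection of y about PI/4 exchanges the two arguments of a mean. *)
Lemma mean_value_even u t :
  (forall y, continuity_2d_pt u t y) ->
  (forall y, u (- t) y = u t (PI / 2 - y)) ->
  mean_value u (- t) = mean_value u t.
Proof.
intros Hc Hs. unfold mean_value. f_equal.
set (I := RInt (u t) 0 (PI / 2)).
apply is_RInt_unique.
apply is_RInt_ext with (fun y => opp (scal (- 1) (u t (- 1 * y + PI / 2)))).
- intros y _. rewrite Hs. unfold opp, scal; simpl; unfold mult; simpl.
  replace (- 1 * y + PI / 2) with (PI / 2 - y) by ring. ring.
- rewrite <- (opp_opp I).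
  apply (is_RInt_opp (V := R_NormedModule)),
    (is_RInt_comp_lin (V := R_NormedModule) (u t) (- 1) (PI / 2) 0 (PI / 2)).
  replace (- 1 * 0 + PI / 2) with (PI / 2) by ring.
  replace (- 1 * (PI / 2) + PI / 2) with 0 by field.
  apply (is_RInt_swap (V := R_NormedModule)).
  apply (RInt_correct (V := R_CompleteNormedModule)), ex_RInt_slice, Hc.
Qed.

Lemma cos_reflect y : cos (2 * (PI / 2 - y)) = - cos (2 * y).
Proof.
replace (2 * (PI / 2 - y)) with (- (2 * y) + PI) by field.
rewrite neg_cos, cos_neg. reflexivity.
Qed.

Lemma bessel_even t : bessel_mean (- t) = bessel_mean t.
Proof.
apply mean_value_even; [apply continuity_2d_bessel|].
intros y. unfold bessel_kernel. rewrite cos_reflect. f_equal. ring.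
Qed.

Lemma legendre_even nu t :
  mean_value (legendre_kernel nu) (- t) = mean_value (legendre_kernel nu) t.
Proof.
apply mean_value_even; [apply continuity_2d_legendre_kernel|].
intros y. unfold legendre_kernel, legendre_base. rewrite cos_reflect.
replace (2 * - t) with (- (2 * t)) by ring. rewrite cosh_opp, sinh_opp.
f_equal. ring.
Qed.

Lemma Rpower_exp x p : Rpower (exp x) p = exp (p * x).
Proof. unfold Rpower. now rewrite ln_exp. Qed.

Lemma log_mean_exp m t : t <> 0 ->
  log_mean (exp (m - t)) (exp (m + t)) = exp m * sinhc t.
Proof.
intros Ht. unfold log_mean, sinhc, sinh. rewrite !ln_exp.
destruct (Req_EM_T t 0); [lra|].
unfold Rminus at 2. rewrite !exp_plus. field. lra.
Qed.

Lemma arith_mean_exp m t :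
  arith_mean (exp (m - t)) (exp (m + t)) = exp m * cosh t.
Proof.
unfold arith_mean, cosh. unfold Rminus. rewrite !exp_plus. field.
Qed.

Lemma power_mean_half_exp m t :
  power_mean_half (exp (m - t)) (exp (m + t)) = exp m * cosh (t / 2) ^ 2.
Proof.
unfold power_mean_half, cosh. rewrite !Rpower_exp.
replace (1 / 2 * (m - t)) with (m / 2 + - (t / 2)) by field.
replace (1 / 2 * (m + t)) with (m / 2 + t / 2) by field.
replace (exp m) with (exp (m / 2) * exp (m / 2))
  by (rewrite <- exp_plus; f_equal; field).
rewrite !exp_plus. field.
Qed.

Lemma quadratic_form_exp m t y :
  exp (m - t) ^ 2 * cos y ^ 2 + exp (m + t) ^ 2 * sin y ^ 2
    = exp m ^ 2 * legendre_base t y.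
Proof.
unfold legendre_base, cosh, sinh, Rminus.
pose proof (sin2_cos2 y) as H. unfold Rsqr in H.
replace (cos (2 * y)) with (cos y * cos y - sin y * sin y)
  by (symmetry; apply cos_2a).
replace (- (2 * t)) with (- t + - t) by ring.
replace (2 * t) with (t + t) by ring.
rewrite !exp_plus.
transitivity (exp m ^ 2 *
  (exp t * exp t * ((sin y * sin y + cos y * cos y)
      - (cos y * cos y - sin y * sin y)) / 2
   + exp (- t) * exp (- t) * ((sin y * sin y + cos y * cos y)
      + (cos y * cos y - sin y * sin y)) / 2)); [field|].
rewrite H. field.
Qed.

Lemma sqrt_quadratic_form_exp m t y :
  sqrt (exp (m - t) ^ 2 * cos y ^ 2 + exp (m + t) ^ 2 * sin y ^ 2)
    = exp m * legendre_kernel (1 / 2) t y.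
Proof.
rewrite quadratic_form_exp, sqrt_mult.
- rewrite sqrt_pow2 by (left; apply exp_pos). f_equal.
  unfold legendre_kernel. replace (1 / 2) with (/ 2) by field.
  symmetry. apply Rpower_sqrt, legendre_base_pos.
- apply pow2_ge_0.
- left. apply legendre_base_pos.
Qed.

Lemma mean_value_scal c u t (f : R -> R) :
  (forall y, continuity_2d_pt u t y) ->
  (forall y, f y = c * u t y) ->
  2 / PI * RInt f 0 (PI / 2) = c * mean_value u t.
Proof.
intros Hc Hf. unfold mean_value.
rewrite (RInt_ext f (fun y => scal c (u t y))) by (intros; apply Hf).
rewrite (RInt_scal (V := R_CompleteNormedModule) (u t))
  by now apply ex_RInt_slice.
unfold scal; simpl; unfold mult; simpl. ring.
Qed.

Lemma toader_mean_exp m t :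
  toader_mean (exp (m - t)) (exp (m + t)) = exp m * toader_norm t.
Proof.
apply mean_value_scal.
- apply continuity_2d_legendre_kernel.
- apply sqrt_quadratic_form_exp.
Qed.

Lemma AGM_exp m t :
  AGM (exp (m - t)) (exp (m + t)) = exp m / agm_recip t.
Proof.
assert (H : 2 / PI * RInt (fun y => / sqrt (exp (m - t) ^ 2 * cos y ^ 2
    + exp (m + t) ^ 2 * sin y ^ 2)) 0 (PI / 2) = / exp m * agm_recip t).
{ apply mean_value_scal.
  - apply continuity_2d_legendre_kernel.
  - intros y. rewrite sqrt_quadratic_form_exp, Rinv_mult. f_equal.
    unfold legendre_kernel. symmetry. apply Rpower_Ropp. }
pose proof PI_RGT_0. pose proof (exp_pos m).
unfold AGM.
replace (RInt _ 0 (PI / 2)) with (PI / 2 * (/ exp m * agm_recip t))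
  by (rewrite <- H; field; lra).
rewrite Rdiv_mult_distr, Rdiv_diag by lra.
unfold Rdiv. rewrite Rinv_mult, Rinv_inv. ring.
Qed.

Lemma toader_qi_mean_exp m t :
  toader_qi_mean (exp (m - t)) (exp (m + t)) = exp m * bessel_mean t.
Proof.
apply mean_value_scal; [apply continuity_2d_bessel|].
intros y. rewrite !Rpower_exp. unfold bessel_kernel.
rewrite <- !exp_plus. f_equal.
pose proof (sin2_cos2 y) as H. unfold Rsqr in H. rewrite cos_2a.
transitivity (m * (sin y * sin y + cos y * cos y)
  - t * (cos y * cos y - sin y * sin y)); [ring|]. rewrite H. ring.
Qed.

Lemma identric_mean_exp m t : t <> 0 ->
  identric_mean (exp (m - t)) (exp (m + t))
    = exp (m + (cosh t / sinhc t - 1)).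
Proof.
intros Ht. unfold identric_mean, Rdiv at 1.
assert (HS : sinh t <> 0).
{ destruct (Rtotal_order t 0) as [H|[H|H]]; [|lra|].
  - pose proof (sinh_lt t 0 H). rewrite sinh_0 in *. lra.
  - pose proof (sinh_pos t H). lra. }
rewrite !Rpower_exp, <- !exp_Ropp, <- exp_plus, Rpower_exp, <- exp_plus.
f_equal. unfold sinhc. destruct (Req_EM_T t 0); [lra|].
assert (Hd : exp (m + t) - exp (m - t) = 2 * exp m * sinh t)
  by (unfold sinh, Rminus; rewrite !exp_plus; field).
assert (Hs : exp (m + t) + exp (m - t) = 2 * exp m * cosh t)
  by (unfold cosh, Rminus; rewrite !exp_plus; field).
pose proof (exp_pos m).
transitivity (- (1) + m + t * (exp (m + t) + exp (m - t))
   / (exp (m + t) - exp (m - t))).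
- field. rewrite Hd. apply Rmult_integral_contrapositive_currified; auto.
  lra.
- rewrite Hd, Hs. field. repeat split; auto; lra.
Qed.

Lemma order_mean_exp M p m t :
  order_mean M p (exp (m - t)) (exp (m + t))
    = Rpower (M (exp (p * m - p * t)) (exp (p * m + p * t))) (1 / p).
Proof.
unfold order_mean. rewrite !Rpower_exp. do 2 f_equal; f_equal; ring.
Qed.

(** * The chain of inequalities *)

Lemma weighted_geometric_mean m t : 0 < t ->
  Rpower (exp m * sinhc t) (3 / 4) * Rpower (exp m * cosh t) (1 / 4)
    = exp m * exp (ln_geometric t).
Proof.
intros Ht. unfold Rpower.
rewrite !ln_mult, ln_exp, <- !exp_plus by
  auto using exp_pos, sinhc_pos, cosh_pos.
f_equal. unfold ln_geometric. field.
Qed.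

Lemma agm_recip_pos t : 0 < t -> 0 < agm_recip t.
Proof. apply (flux_F_pos _ _ _ _ (legendre_flux (- (1 / 2)))). Qed.

Lemma toader_norm_pos t : 0 < t -> 0 < toader_norm t.
Proof. apply (flux_F_pos _ _ _ _ (legendre_flux (1 / 2))). Qed.

Lemma arithmetic_lt_power_half t : 0 < t ->
  3 / 4 * sinhc t + 1 / 4 * cosh t < cosh (t / 2) ^ 2.
Proof.
intros Ht. rewrite sinhc_pos_eq by exact Ht.
rewrite cosh_sqr. pose proof (cosh_double (t / 2)) as H.
replace (2 * (t / 2)) with t in H by field.
pose proof (cusa_huygens_hyperbolic t Ht).
assert (sinh t / t < (2 + cosh t) / 3) by (apply Rlt_div_l; lra).
lra.
Qed.

(** Each strict inequality is one of the normalized comparisons multiplied by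
    exp m; those involving the Toader mean of order 1/3 and the identric mean
    of order 3/4 are taken at t/3, since 9/4 (t/3) = 3/4 t. *)
Lemma chain_normalized (m t : R) : 0 < t ->
  exp m * sinhc t < exp m / agm_recip t /\
  exp m / agm_recip t
    < Rpower (exp m * sinhc t) (3 / 4) * Rpower (exp m * cosh t) (1 / 4) /\
  Rpower (exp m * sinhc t) (3 / 4) * Rpower (exp m * cosh t) (1 / 4)
    < exp m * bessel_mean t /\
  exp m * bessel_mean t
    < 3 / 4 * (exp m * sinhc t) + 1 / 4 * (exp m * cosh t) /\
  3 / 4 * (exp m * sinhc t) + 1 / 4 * (exp m * cosh t)
    < exp m * cosh (t / 2) ^ 2 /\
  exp m * cosh (t / 2) ^ 2
    < Rpower (exp (1 / 3 * m) * toader_norm (1 / 3 * t)) (1 / (1 / 3)) /\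
  Rpower (exp (1 / 3 * m) * toader_norm (1 / 3 * t)) (1 / (1 / 3))
    < Rpower (exp (3 / 4 * m + (cosh (3 / 4 * t) / sinhc (3 / 4 * t) - 1)))
        (1 / (3 / 4)).
Proof.
intros Ht. pose proof (exp_pos m). pose proof (agm_recip_pos t Ht).
pose proof (toader_norm_pos (1 / 3 * t) ltac:(lra)) as HUp.
assert (HT : Rpower (exp (1 / 3 * m) * toader_norm (1 / 3 * t)) (1 / (1 / 3))
  = exp (m + 3 * ln (toader_norm (1 / 3 * t)))).
{ unfold Rpower. rewrite ln_mult, ln_exp by auto using exp_pos.
  f_equal. field. }
rewrite HT, weighted_geometric_mean by exact Ht.
repeat split.
- apply Rmult_lt_compat_l; auto.
  rewrite <- (Rinv_inv (sinhc t)).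
  apply Rinv_lt_contravar; [|now apply agm_recip_lt_inv_sinhc].
  apply Rmult_lt_0_compat; auto. apply Rinv_0_lt_compat, sinhc_pos, Ht.
- apply Rmult_lt_compat_l; auto.
  rewrite <- (Rinv_inv (exp (ln_geometric t))), <- exp_Ropp.
  apply Rinv_lt_contravar; [|now apply inv_geometric_lt_agm_recip].
  apply Rmult_lt_0_compat; auto using exp_pos.
- apply Rmult_lt_compat_l; auto. now apply geometric_lt_bessel_mean.
- pose proof (Rmult_lt_compat_l (exp m) _ _ H
    (bessel_mean_lt_arithmetic t Ht)). lra.
- pose proof (Rmult_lt_compat_l (exp m) _ _ H
    (arithmetic_lt_power_half t Ht)). lra.
- pose proof (cosh_pos (t / 2)) as Hc.
  replace (cosh (t / 2) ^ 2) with (exp (2 * ln (cosh (t / 2)))).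
  + rewrite <- exp_plus. apply exp_increasing.
    pose proof (power_mean_lt_toader (1 / 3 * t) ltac:(lra)) as H6.
    apply ln_increasing in H6; [|apply exp_pos]. rewrite ln_exp in H6.
    replace (3 / 2 * (1 / 3 * t)) with (t / 2) in H6 by field. lra.
  + replace (2 * ln (cosh (t / 2))) with (ln (cosh (t / 2)) + ln (cosh (t / 2)))
      by ring. rewrite exp_plus, exp_ln by exact Hc. ring.
- rewrite Rpower_exp. apply exp_increasing.
  pose proof (toader_lt_identric (1 / 3 * t) ltac:(lra)) as H7.
  apply ln_increasing in H7; [|exact HUp]. rewrite ln_exp in H7.
  replace (9 / 4 * (1 / 3 * t)) with (3 / 4 * t) in H7 by field. lra.
Qed.

Theorem mainTheorem7 :
  forall a b : R, 0 < a -> 0 < b -> a <> b ->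
    log_mean a b < AGM a b /\
    AGM a b < Rpower (log_mean a b) (3 / 4) * Rpower (arith_mean a b) (1 / 4) /\
    Rpower (log_mean a b) (3 / 4) * Rpower (arith_mean a b) (1 / 4)
      < toader_qi_mean a b /\
    toader_qi_mean a b < 3 / 4 * log_mean a b + 1 / 4 * arith_mean a b /\
    3 / 4 * log_mean a b + 1 / 4 * arith_mean a b < power_mean_half a b /\
    power_mean_half a b < order_mean toader_mean (1 / 3) a b /\
    order_mean toader_mean (1 / 3) a b < order_mean identric_mean (3 / 4) a b.
Proof.
intros a b Ha Hb Hab.
set (m := (ln a + ln b) / 2). set (t := (ln b - ln a) / 2).
replace a with (exp (m - t))
  by (rewrite <- (exp_ln a Ha); f_equal; unfold m, t; field).
replace b with (exp (m + t))
  by (rewrite <- (exp_ln b Hb); f_equal; unfold m, t; field).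
assert (Ht : t <> 0).
{ unfold t. intros H. apply Hab, ln_inv; auto; lra. }
clearbody m t.
rewrite !order_mean_exp, toader_mean_exp, identric_mean_exp by lra.
rewrite log_mean_exp, AGM_exp, arith_mean_exp, toader_qi_mean_exp,
  power_mean_half_exp by exact Ht.
destruct (Rlt_or_le 0 t) as [Hp|Hn]; [now apply chain_normalized|].
assert (Hs : exists s, 0 < s /\ t = - s) by (exists (- t); lra).
destruct Hs as [s [Hs ->]].
replace (1 / 3 * - s) with (- (1 / 3 * s)) by ring.
replace (3 / 4 * - s) with (- (3 / 4 * s)) by ring.
replace (- s / 2) with (- (s / 2)) by field.
rewrite !sinhc_opp, !cosh_opp, bessel_even, !legendre_even.
now apply chain_normalized.
Qed.
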